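(* Let $X$ be a Fort space and let $n\ge 0$ be an integer. Let $\Xi$ be the collection of all sequences that occur as the indicator sequence of some transformation group $(X,S)$ with phase space $X$ and height $h(X,S)=n$. Then: (i) if $X$ is infinite, $\Xi=\{(p_0,\ldots,p_n)\in\{0,1\}^{n+1}: 0=p_0\leq p_1\leq\cdots\leq p_n=1\}$; (ii) if $X$ is finite and $n$ is the height of at least one transformation group with phase space $X$, $\Xi=\{(0,\ldots,0)\}$ (the zero sequence of length $n+1$). In particular, if $X$ is infinite then $h(X,S)>0$ for every transformation group $(X,S)$.
   Context: A transformation group $(Y,S)$ consists of a (nonempty) compact Hausdorff space $Y$, a discrete group $S$ with identity $e$, and a continuous map $Y\times S\to Y$, $(x,s)\mapsto xs$, with $xe=x$ and $x(st)=(xs)t$ for all $x\in Y$, $s,t\in S$. Write $xS=\{xs:s\in S\}$. A nonempty subset $Z\subseteq Y$ is invariant if $zs\in Z$ for all $z\in Z$, $s\in S$. For a nonempty closed invariant $W\subseteq Y$, the height $h(W)\in\{0,1,2,\ldots\}\cup\{\infty\}$ is the supremum of all $n\ge 0$ for which there are distinct nonempty closed invariant subsets $Z_0\subset\cdots\subset Z_n=W$ of $(Y,S)$; $h(Y)$ is also written $h(Y,S)$. For finite $p\geq 0$, $h(Y,S)=p$ if and only if $\{\overline{yS}:y\in Y\}$ has exactly $p+1$ elements. If $h(Y,S)=p<\infty$, choose $y_0,\ldots,y_p\in Y$ with $\{\overline{yS}:y\in Y\}=\{\overline{y_0S},\ldots,\overline{y_pS}\}$ and $h(\overline{y_0S})\le\cdots\le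 h(\overline{y_pS})$; the indicator sequence of $(Y,S)$ is $(h(\overline{y_0S}),\ldots,h(\overline{y_pS}))$. It is defined only for finite height. A Fort space with particular point $b\in X$ is a set $X$ with the topology $\{U\subseteq X: b\notin U\text{ or }X\setminus U\text{ is finite}\}$ ($X$ may be finite or infinite). *)

(* Defs.v *)
From mathcomp Require Export all_boot all_order.
From mathcomp Require Export all_classical topology.

Set Implicit Arguments.
Unset Strict Implicit.
Unset Printing Implicit Defensive.

Local Open Scope classical_set_scope.

(* Right action of a group S, carried by its discrete topology, on a nonempty
   compact Hausdorff space Y; [tg_act x s] is the point written xs. *)
Record transformation_group (Y : topologicalType) (S : groupType) := {
  tg_act :> Y -> S -> Y;
  tg_nonempty : [set: Y] !=set0;
  tg_compact : compact [set: Y];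
  tg_hausdorff : hausdorff_space Y;
  tg_continuous :
    continuous (fun xs : (Y * discrete_topology S)%type => tg_act xs.1 xs.2);
  tg_act1 : forall x : Y, tg_act x 1%g = x;
  tg_actM : forall (x : Y) (s t : S), tg_act x (s * t)%g = tg_act (tg_act x s) t
}.

Definition fort_space (X : topologicalType) (b : X) : Prop :=
  forall U : set X, open U <-> (~ U b \/ finite_set (~` U)).

(* Natural numbers extended with infinity, represented by [None]. *)
Definition enat := option nat.

Definition enat_lt (m n : enat) : bool :=
  match m, n with
  | Some p, Some q => p < q
  | Some _, None => true
  | None, _ => false
  end.

Section Height.
Variables (Y : topologicalType) (S : groupType) (a : transformation_group Y S).

Definition tg_orbit (x : Y) : set Y := range (a x).

Definition tg_invariant (Z : set Y) : Prop :=
  Z !=set0 /\ forall z s, Z z -> Z (a z s).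

Definition chain_lengths (W : set Y) : set nat :=
  [set n | exists Z : 'I_n.+1 -> set Y,
     [/\ forall i, closed (Z i) /\ tg_invariant (Z i),
         forall i j : 'I_n.+1, i < j -> Z i `<` Z j
       & Z ord_max = W]].

(* Only meaningful for W nonempty, closed and invariant, in which case
   [chain_lengths W] contains 0. *)
Definition height (W : set Y) : enat :=
  if `[< has_ubound (chain_lengths W) >]
  then Some (supremum 0 (chain_lengths W)) else None.

(* The sequence [t] of length p+1 is the indicator sequence of [a], whose
   height is p. *)
Definition indicator_sequence (p : nat) (t : p.+1.-tuple nat) : Prop :=
  height [set: Y] = Some p /\
  exists y : 'I_p.+1 -> Y,
    [/\ [set closure (tg_orbit x) | x in [set: Y]] =
          [set closure (tg_orbit (y i)) | i in [set: 'I_p.+1]],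
        sorted leq t
      & forall i, height (closure (tg_orbit (y i))) = Some (tnth t i)].

End Height.

Definition indicator_sequences (X : topologicalType) (n : nat) :
    set (n.+1.-tuple nat) :=
  [set t | exists (S : groupType) (a : transformation_group X S),
     indicator_sequence a t].

Arguments indicator_sequences : clear implicits.

(* Main.v *)
Require Import Defs.
From HB Require Import structures.

(** In a Fort space with particular point [b] a set is closed exactly when it
    contains [b] or is finite ([fort_closed]).  Everything follows from this
    dichotomy.

    A finite orbit is its own closure and contains no smaller invariant set,
    so it has height 0 ([height_finite_orbit]).  An infinite orbit can only
    occur when [X] is infinite; then [b] is the unique non-isolated point, so
    every group element fixes it ([fixed_point]).  The closure of an infinite
    orbit adds just the point [b] ([closure_infinite_orbit]), and the only
    closed invariant sets inside it are [{b}] and the whole, so its height is 1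
    ([height_infinite_orbit]).

    If [X] is infinite, an indicator sequence is therefore a nondecreasing
    sequence of zeros and ones.  It starts with 0 because of the orbit [{b}],
    and ends with 1 because otherwise [X] would be a finite union of finite
    orbit closures ([indicator_infinite]).  Conversely, given such a sequence,
    colour [X] with the colours [0, ..., n] so that [b] alone has colour 0 and
    the colour class of [i] is finite or infinite according to the [i]-th entry
    ([fiber_labelling]).  The group of all permutations of [X] that preserve
    colours acts continuously, since it fixes [b], and its orbits are the colour
    classes, since it contains the transpositions of points of equal colour.
    Its closed invariant sets are unions of colour classes, and every union
    containing the class of [b] is closed, which makes the height equal to the
    number of colours minus one ([height_fibers]).

    If [X] is finite it is discrete and every orbit closure has height 0.  What
    remains is that a group of height [n] has at most [n + 1] orbits, so that
    representatives can be indexed as required ([finite_orbit_reps]): the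
    differences of consecutive members of a longest chain provide [n + 1]
    points, and an orbit missed by them would lengthen the chain. *)

Set Implicit Arguments.
Unset Strict Implicit.
Unset Printing Implicit Defensive.

Local Open Scope classical_set_scope.

(** * Chains of closed invariant sets and orbits *)

Section Chains.
Variables (Y : topologicalType) (S : groupType) (a : transformation_group Y S).

Lemma height_eq (W : set Y) m :
  chain_lengths a W m -> ubound (chain_lengths a W) m -> height a W = Some m.
Proof.
move=> Wm ubm; rewrite /height asboolT; last by exists m.
congr Some; rewrite /supremum ifF; last by apply/negbTE/set0P; exists m.
have mP : supremums (chain_lengths a W) m by split=> [|k ubk]; [|exact: ubk].
have xP := xgetPex 0 (ex_intro _ m mP).
exact: is_subset1_supremums xP mP.
Qed.

Lemma chain_lengths0 (W : set Y) :
  closed W -> tg_invariant a W -> chain_lengths a W 0.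
Proof.
move=> clW invW; exists (fun=> W); split=> [//|i j|//].
by rewrite (ord1 i) (ord1 j).
Qed.

Lemma chain_lengthsS (A W : set Y) m : chain_lengths a A m ->
  closed W -> tg_invariant a W -> A `<` W -> chain_lengths a W m.+1.
Proof.
move=> [Z [ZP ltZ Zmax]] clW invW AW.
exists (fun i : 'I_m.+2 => if i <= m then Z (inord i) else W).
split; last by rewrite ltnn.
  by move=> i; case: ifP.
move=> i j ij; have im : i <= m by rewrite -ltnS (leq_trans ij) // -ltnS.
rewrite im; case: ifPn => jm; first by apply: ltZ; rewrite !inordK.
have ZiA : Z (inord i) `<=` A.
  rewrite -Zmax; have [->//|imax] := eqVneq (inord i) (@ord_max m).
  by apply: (proj1 (ltZ _ _ _)); rewrite ltn_neqAle imax leq_ord.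
split; first exact: subset_trans ZiA AW.1.
by move=> WZi; apply: AW.2; exact: subset_trans WZi ZiA.
Qed.

Lemma chain_lengths1 (A W : set Y) :
    closed A -> tg_invariant a A -> closed W -> tg_invariant a W ->
  A `<` W -> chain_lengths a W 1.
Proof. by move=> clA invA; apply: chain_lengthsS; exact: chain_lengths0. Qed.

(** A finite height is attained by a chain: a bounded set of naturals that
    contains 0, the length of the chain reduced to [W], has a maximum. *)
Lemma height_Some (W : set Y) m : closed W -> tg_invariant a W ->
  height a W = Some m -> chain_lengths a W m /\ ubound (chain_lengths a W) m.
Proof.
move=> clW invW hW.
have [M ubM] : has_ubound (chain_lengths a W).
  by move: hW; rewrite /height; case: asboolP.
have ex0 : exists k, `[< chain_lengths a W k >].
  by exists 0; apply/asboolP/chain_lengths0.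
have ubM' k : `[< chain_lengths a W k >] -> k <= M by move=> /asboolP /ubM.
case: (ex_maxnP ex0 ubM') => k /asboolP Wk kmax.
have ubk : ubound (chain_lengths a W) k by move=> j Wj; apply/kmax/asboolP.
by move: hW; rewrite (height_eq Wk ubk) => -[<-].
Qed.

Lemma mem_orbit x : tg_orbit a x x.
Proof. by exists 1%g => //; rewrite tg_act1. Qed.

Lemma orbit_act x z s : tg_orbit a x z -> tg_orbit a x (a z s).
Proof. by move=> [t _ <-]; exists (t * s)%g => //; rewrite tg_actM. Qed.

Lemma tg_actK x s : a (a x s) s^-1%g = x.
Proof. by rewrite -tg_actM mulgV tg_act1. Qed.

Lemma orbit_sym x y : tg_orbit a x y -> tg_orbit a y x.
Proof. by move=> [t _ <-]; exists t^-1%g => //; rewrite tg_actK. Qed.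

Lemma orbit_trans x y z : tg_orbit a x y -> tg_orbit a y z -> tg_orbit a x z.
Proof. by move=> xy [t _ <-]; exact: orbit_act. Qed.

Lemma orbit_eq x y : tg_orbit a x y -> tg_orbit a x = tg_orbit a y.
Proof.
move=> xy; apply/seteqP; split=> z; apply: orbit_trans => //.
exact: orbit_sym.
Qed.

Lemma invariant_orbit x : tg_invariant a (tg_orbit a x).
Proof. by split; [exists x; exact: mem_orbit|exact: orbit_act]. Qed.

Lemma orbit_subset (Z : set Y) x :
  tg_invariant a Z -> Z x -> tg_orbit a x `<=` Z.
Proof. by move=> [_ invZ] Zx _ [s _ <-]; exact: invZ. Qed.

Lemma invariantT : tg_invariant a [set: Y].
Proof. by split=> //; exact: tg_nonempty a. Qed.

(** Adding pairwise distinct orbits one at a time gives a chain. *)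
Lemma orbit_chain (y : nat -> Y) (m : nat) :
    (forall i j, i < j <= m -> ~ tg_orbit a (y i) (y j)) ->
    (forall i, i <= m -> closed (\bigcup_(k in `I_i.+1) tg_orbit a (y k))) ->
  chain_lengths a (\bigcup_(k in `I_m.+1) tg_orbit a (y k)) m.
Proof.
move=> disj cl.
exists (fun i : 'I_m.+1 => \bigcup_(k in `I_i.+1) tg_orbit a (y k)); split=> //.
  move=> i; split; first by apply: cl; rewrite -ltnS.
  split; first by exists (y i); exists i => /=; [exact: ltnSn|exact: mem_orbit].
  by move=> z s [k ki kz]; exists k => //; exact: orbit_act.
move=> i j ij; split.
  by move=> z [k /= ki kz]; exists k => //=; rewrite (leq_trans ki) // ltnW.
move=> /(_ (y j)) H.
have H' : (\bigcup_(k in `I_j.+1) tg_orbit a (y k)) (y j).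
  by exists j => /=; [exact: ltnSn|exact: mem_orbit].
have [k /= ki] := H H'.
by apply: disj; rewrite (leq_ltn_trans _ ij) //= -ltnS.
Qed.

End Chains.

(** * Transformation groups on a Fort space *)

Section Fort.
Variables (X : topologicalType) (b : X).
Hypothesis fortX : fort_space b.

Lemma fort_closed (Z : set X) : closed Z <-> Z b \/ finite_set Z.
Proof.
rewrite -openC; split.
  by move=> /fortX; rewrite setCK => -[/contrapT|]; [left|right].
by move=> H; apply/fortX; rewrite setCK; case: H => ?; [left=> /=|right].
Qed.

Lemma fort_open1 (x : X) : x <> b -> open [set x].
Proof. by move=> xb; apply/fortX; left=> /= bx; apply: xb. Qed.

(** Of two distinct points one differs from [b]; its singleton is clopen and
    separates them. *)
Lemma fort_hausdorff : hausdorff_space X.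
Proof.
have sep (x y : X) : x != y -> x <> b ->
    open [set x] /\ open (~` [set x]) /\ (~` [set x]) y.
  move=> /eqP xy xb; split; first exact: fort_open1.
  split; last by move=> /= yx; apply: xy.
  by apply/fortX; right; rewrite setCK; exact: finite_set1.
rewrite open_hausdorff => x y xy; have [xb|xb] := pselect (x = b).
  have yb : y <> b by move/eqP: xy; rewrite xb => + yb; apply.
  have [] := sep y x; rewrite 1?eq_sym // => o1 [o2 xC].
  exists (~` [set y], [set y]); rewrite /= ?inE; first by split.
  by split=> //; rewrite setIC setICr.
have [] := sep x y => // o1 [o2 yC].
exists ([set x], ~` [set x]); rewrite /= ?inE; first by split.
by split=> //; rewrite setICr.
Qed.

(** A proper filter that does not cluster at [b] contains a set missing a
    neighbourhood of [b].  That set is finite, hence compact. *)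
Lemma fort_compact : compact [set: X].
Proof.
move=> F FF _; have [clb|] := pselect (cluster F b); first by exists b.
rewrite /cluster /= => nclb.
have [A [B [FA nB AB0]]] : exists A B, [/\ F A, nbhs b B & ~ (A `&` B !=set0)].
  apply: contrapT => H; apply: nclb => A B FA nB.
  by apply: contrapT => AB; apply: H; exists A, B.
have finA : finite_set A.
  move: nB; rewrite nbhsE => -[U [oU Ub] UB].
  have [|] := (fortX U).1 oU; first by move=> /(_ Ub).
  apply: sub_finite_set => x Ax Ux; apply: AB0; exists x; split=> //.
  exact: UB.
have [x [_ Fx]] := finite_compact finA FF FA.
by exists x.
Qed.

Section Action.
Variables (S : groupType) (a : transformation_group X S).

(** If [s] moved [b] to another point, necessarily isolated, then by continuity
    a cofinite neighbourhood of [b] would be sent to that single point; as [s]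
    acts injectively, [X] would be finite. *)
Lemma fixed_point s : infinite_set [set: X] -> a b s = b.
Proof.
move=> infX; apply: contrapT => bsb; apply: infX.
have /(_ [set a b s]) := @tg_continuous _ _ a (b, s).
case; first exact: (open_nbhs_nbhs (conj (fort_open1 bsb) _)).
move=> [P Q] /= [nP nQ] PQ.
move: nP; rewrite nbhsE => -[U [oU Ub] UP].
have Us : Q s by exact: (nbhs_singleton nQ).
have [|finU] := (fortX U).1 oU; first by move=> /(_ Ub).
apply: (@sub_finite_set _ _ ([set b] `|` ~` U)).
  move=> x _; have [Ux|] := pselect (U x); last by right.
  left => /=; have /= xb := PQ (x, s) (conj (UP _ Ux) Us).
  by rewrite -(tg_actK a x s) xb tg_actK.
by rewrite finite_setU; split=> //; exact: finite_set1.
Qed.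

Lemma invariant_point : infinite_set [set: X] -> tg_invariant a [set b].
Proof.
by move=> infX; split; [exists b|move=> _ s ->; exact: fixed_point].
Qed.

(** The orbit is closed, and an invariant set inside an orbit is all of it. *)
Lemma height_finite_orbit x : finite_set (tg_orbit a x) ->
  height a (closure (tg_orbit a x)) = Some 0.
Proof.
move=> finO; have clO : closed (tg_orbit a x) by apply/fort_closed; right.
rewrite -((closure_id _).1 clO).
apply: height_eq; first exact: chain_lengths0 (invariant_orbit a x).
move=> [//|m] [Z [ZP ltZ Zmax]].
have [[z Z0z] invZ] := (ZP ord0).2.
have [sub nsub] := ltZ ord0 ord_max isT.
have Oxz : tg_orbit a x z by rewrite -Zmax; exact: sub.
exfalso; apply: nsub; rewrite Zmax (orbit_eq Oxz).
exact: orbit_subset (ZP ord0).2 Z0z.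
Qed.

(** Containing [b] is enough to be closed, and necessary for an infinite set. *)
Lemma closure_infinite_orbit x : infinite_set (tg_orbit a x) ->
  closure (tg_orbit a x) = b |` tg_orbit a x.
Proof.
move=> infO; apply/seteqP; split.
  have clO : closed (b |` tg_orbit a x) by apply/fort_closed; left; left.
  by rewrite [X in _ `<=` X](closure_id _).1 //; apply: closureS => y; right.
rewrite subUset; split; last exact: subset_closure.
move=> _ ->.
have [//|fin] := (fort_closed _).1 (@closed_closure _ (tg_orbit a x)).
by exfalso; apply/infO/(sub_finite_set _ fin)/subset_closure.
Qed.

(** A longest chain is [{b}] followed by the closure itself. *)
Lemma height_infinite_orbit x : infinite_set (tg_orbit a x) ->
  height a (closure (tg_orbit a x)) = Some 1.
Proof.
move=> infO.
have infX : infinite_set [set: X] by apply: sub_infinite_set infO.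
have cE := closure_infinite_orbit infO.
have nOb : ~ tg_orbit a x b.
  move=> /orbit_eq OxE; apply: infO; rewrite OxE.
  apply: (sub_finite_set _ (finite_set1 b)).
  exact: (orbit_subset (invariant_point infX)).
have invC : tg_invariant a (closure (tg_orbit a x)).
  rewrite cE; split; first by exists b; left.
  move=> z s [->|xz]; first by left; exact: fixed_point.
  by right; exact: orbit_act.
apply: height_eq.
  apply: (@chain_lengths1 _ _ _ [set b]) => //.
  - by apply/fort_closed; left.
  - exact: invariant_point.
  - exact: closed_closure.
  - rewrite cE; split; first by move=> y ->; left.
    move=> /(_ x (or_intror (mem_orbit a x))) /= xb.
    by apply: nOb; rewrite -xb; exact: mem_orbit.
(* a closed invariant set meeting the orbit contains its closure, so a proper
   one is [{b}] *)
have proper Z : closed Z -> tg_invariant a Z -> Z `<` closure (tg_orbit a x) ->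
    Z = [set b].
  move=> clZ invZ [sub nsub].
  have Zb : Z `<=` [set b].
    move=> z Zz; move: (sub _ Zz); rewrite cE => -[//|xz].
    exfalso; apply: nsub.
    rewrite (orbit_eq xz) [X in _ `<=` X](closure_id _).1 //.
    by apply: closureS; exact: orbit_subset.
  apply/seteqP; split=> // _ ->.
  by have [z Zz] := invZ.1; rewrite -(Zb _ Zz).
move=> [//|[//|m]] [Z [ZP ltZ Zmax]]; exfalso.
pose i1 : 'I_m.+3 := Ordinal (isT : 1 < m.+3).
have Z0 : Z ord0 = [set b].
  by apply: proper; [exact: (ZP _).1|exact: (ZP _).2|rewrite -Zmax; exact: ltZ].
have Z1 : Z i1 = [set b].
  by apply: proper; [exact: (ZP _).1|exact: (ZP _).2|rewrite -Zmax; exact: ltZ].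
by have := ltZ ord0 i1 isT; rewrite Z0 Z1 => -[_]; apply.
Qed.

Lemma height_gt0 : infinite_set [set: X] -> enat_lt (Some 0) (height a [set: X]).
Proof.
move=> infX; case hX: (height a [set: X]) => [m|//] /=.
have [_ ubm] := height_Some closedT (invariantT a) hX.
apply: ubm; apply: (@chain_lengths1 _ _ _ [set b]) => //.
- by apply/fort_closed; left.
- exact: invariant_point.
- exact: invariantT.
- by split=> // /sub_finite_set -/(_ (finite_set1 b)) /infX.
Qed.

End Action.

(** Pick [y i] in the [i]-th member [Z i] of a longest chain but in no earlier
    one.  The orbits of the [y i] are then distinct, and they form a chain of
    length [n] up to their union.  If that union were not [X], appending [X]
    would give a chain longer than the height allows. *)
Lemma finite_orbit_reps (S : groupType) (a : transformation_group X S) n :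
    finite_set [set: X] -> height a [set: X] = Some n ->
  exists y : 'I_n.+1 -> X, forall x, exists i, tg_orbit a (y i) x.
Proof.
move=> finX hX.
have cl (Z : set X) : closed Z.
  by apply/fort_closed; right; exact: sub_finite_set finX.
have [[Z [ZP ltZ Zmax]] ubn] := height_Some (cl _) (invariantT a) hX.
have new (i : 'I_n.+1) :
    exists x, Z i x /\ forall j : 'I_n.+1, j < i -> ~ Z j x.
  have [i0|i0] := posnP i.
    by have [[x Zx] _] := (ZP i).2; exists x; split=> // j; rewrite i0.
  have lti : i.-1 < n.+1 by rewrite (leq_ltn_trans (leq_pred _)).
  have [|_ /existsNP[x /not_implyP[Zx nZx]]] := ltZ (Ordinal lti) i.
    by rewrite /= prednK.
  exists x; split=> // j ji Zj; apply: nZx.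
  have : j <= Ordinal lti by rewrite /= -ltnS prednK.
  by rewrite leq_eqVlt => /orP[/eqP/val_inj <-//|/ltZ[+ _]]; exact.
pose y i := sval (cid (new i)).
have Zy i : Z i (y i) by exact: (svalP (cid (new i))).1.
have nZy (i j : 'I_n.+1) : j < i -> ~ Z j (y i).
  exact: (svalP (cid (new i))).2.
exists y => x; apply: contrapT => /forallNP nx.
suff /ubn : chain_lengths a [set: X] n.+1 by rewrite [(_ <= _)%O]ltnn.
apply: (@chain_lengthsS _ _ _
  (\bigcup_(k in `I_n.+1) tg_orbit a (y (inord k)))).
- apply: orbit_chain => // i j /andP[ij jn] Oij.
  have lt : @inord n i < @inord n j.
    by rewrite !inordK // ltnS (leq_trans (ltnW ij)).
  by apply: (nZy _ _ lt); exact: (orbit_subset (ZP _).2 (Zy _)).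
- exact: cl.
- exact: invariantT.
- by split=> // /(_ x I)[k _ /nx].
Qed.

End Fort.

(** * The group of fibre-preserving permutations *)

Section FiberPerm.
Variables (X I : Type) (f : X -> I).

(** The inverse is stored as data, so that it need not be chosen; it is
    determined by the permutation, see [fiber_permP]. *)
Record fiber_perm := FiberPerm {
  fp_fun :> X -> X;
  fp_inv : X -> X;
  fp_funK : cancel fp_fun fp_inv;
  fp_invK : cancel fp_inv fp_fun;
  fp_fiber : forall x, f (fp_fun x) = f x
}.

Lemma fiber_permP (s t : fiber_perm) : s =1 t -> s = t.
Proof.
case: s t => [s s' sK s'K sf] [t t' tK t'K tf] /= /funext st; subst t.
have ? : s' = t' by apply/funext => x; rewrite -{1}(t'K x) sK.
by subst t'; congr FiberPerm; exact: Prop_irrelevance.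
Qed.

HB.instance Definition _ := gen_eqMixin fiber_perm.
HB.instance Definition _ := gen_choiceMixin fiber_perm.

Definition fp_one : fiber_perm :=
  @FiberPerm id id (fun=> erefl) (fun=> erefl) (fun=> erefl).

Lemma fp_inv_fiber (s : fiber_perm) x : f (fp_inv s x) = f x.
Proof. by rewrite -(fp_fiber s) fp_invK. Qed.

Definition fp_inverse (s : fiber_perm) : fiber_perm :=
  FiberPerm (@fp_invK s) (@fp_funK s) (fp_inv_fiber s).

Lemma fp_comp_fiber (s t : fiber_perm) x : f (t (s x)) = f x.
Proof. by rewrite !fp_fiber. Qed.

(** The factor [s] is applied first, as a right action requires. *)
Definition fp_mul (s t : fiber_perm) : fiber_perm :=
  FiberPerm (can_comp (@fp_funK t) (@fp_funK s))
    (can_comp (@fp_invK s) (@fp_invK t)) (fp_comp_fiber s t).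

Lemma fp_mulA : associative fp_mul.
Proof. by move=> r s t; exact: fiber_permP. Qed.

Lemma fp_mul1 : left_id fp_one fp_mul.
Proof. by move=> s; exact: fiber_permP. Qed.

Lemma fp_mulr1 : right_id fp_one fp_mul.
Proof. by move=> s; exact: fiber_permP. Qed.

Lemma fp_mulV : left_inverse fp_one fp_inverse fp_mul.
Proof. by move=> s; apply: fiber_permP => x; exact: fp_invK. Qed.

Lemma fp_mulVr : right_inverse fp_one fp_inverse fp_mul.
Proof. by move=> s; apply: fiber_permP => x; exact: fp_funK. Qed.

HB.instance Definition _ :=
  isGroup.Build fiber_perm fp_mulA fp_mul1 fp_mulr1 fp_mulV fp_mulVr.

End FiberPerm.

Section FiberTransposition.
Variables (X : eqType) (I : Type) (f : X -> I) (x y : X).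

Definition transpose (z : X) := if z == x then y else if z == y then x else z.

Lemma transposeK : involutive transpose.
Proof.
move=> z; rewrite /transpose; case: (eqVneq z x) => [->|zx].
  by case: (eqVneq y x) => [->|_]; rewrite ?eqxx.
by case: (eqVneq z y) => [->|zy]; rewrite ?eqxx // (negbTE zx) (negbTE zy).
Qed.

Lemma transpose_fiber : f x = f y -> forall z, f (transpose z) = f z.
Proof. by move=> fxy z; rewrite /transpose; do 2![case: eqP => [->//|_]]. Qed.

Definition fiber_transpose (fxy : f x = f y) : fiber_perm f :=
  FiberPerm transposeK transposeK (transpose_fiber fxy).

End FiberTransposition.

Section FiberAction.
Variables (X : topologicalType) (b : X).
Hypothesis fortX : fort_space b.
Variables (I : Type) (f : X -> I).
Hypothesis fiber_b : forall x, f x = f b -> x = b.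

(** When [b] is alone in its fibre it is fixed, and any injection fixing [b] is
    continuous: preimages keep missing [b], or keep a finite complement. *)
Lemma fiber_perm_continuous (s : fiber_perm f) : continuous s.
Proof.
have sb : s b = b by apply: fiber_b; exact: fp_fiber.
apply/continuousP => U /fortX oU; apply/fortX.
case: oU => [nUb|finU]; first by left; rewrite /preimage /= sb.
right; rewrite preimage_setC; apply: finite_preimage finU.
by move=> x y _ _; exact: (can_inj (@fp_funK _ _ _ s)).
Qed.

Definition fiber_action : transformation_group X (fiber_perm f).
Proof.
apply: (@Build_transformation_group X (fiber_perm f) (fun x s => s x)).
- by exists b.
- exact: (fort_compact fortX).
- exact: (fort_hausdorff fortX).
- move=> [x s] U nU.
  exists (s @^-1` U, [set s]) => /=.
    by split; [exact: fiber_perm_continuous|exact: discrete_set1].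
  by move=> [z t] /= [Uz ->].
- by [].
- by [].
Defined.

(** Two points of a fibre are exchanged by their transposition. *)
Lemma orbit_fiber_action x : tg_orbit fiber_action x = f @^-1` [set f x].
Proof.
apply/seteqP; split=> [_ [s _ <-]|y /esym fxy]; first exact: fp_fiber.
by exists (fiber_transpose fxy) => //=; rewrite /transpose eqxx.
Qed.

End FiberAction.

Lemma proper_chain_card (T : finType) m (L : 'I_m.+1 -> {set T}) :
    L ord0 != finset.set0 -> (forall i j : 'I_m.+1, i < j -> L i \proper L j) ->
  m < #|T|.
Proof.
move=> L0 ltL; suff H k (km : k < m.+1) : k < #|L (Ordinal km)|.
  exact: leq_trans (H m (ltnSn m)) (max_card _).
elim: k km => [|k IHk] km.
  by rewrite card_gt0 (_ : Ordinal km = ord0) //; exact: val_inj.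
apply: leq_ltn_trans (IHk (ltnW km)) _.
by apply: proper_card; exact: ltL.
Qed.

(** Label the orbits by their values under [f].  Invariant sets correspond to
    sets of labels, so a chain has at most [n + 1] members.  Adding the orbits
    in the order of their labels reaches this bound: all the partial unions
    contain [b] and hence are closed. *)
Lemma height_fibers (X : topologicalType) (b : X) (fortX : fort_space b)
    (S : groupType) (a : transformation_group X S) n (f : X -> 'I_n.+1) :
    f b = ord0 -> (forall i, exists x, f x = i) ->
    (forall x, tg_orbit a x = f @^-1` [set f x]) ->
  height a [set: X] = Some n.
Proof.
move=> fb surj orbE; apply: height_eq.
  pose y k := sval (cid (surj (inord k))).
  have fy k : f (y k) = inord k by exact: svalP (cid (surj (inord k))).
  have -> : [set: X] = \bigcup_(k in `I_n.+1) tg_orbit a (y k).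
    apply/seteqP; split=> // x _; exists (f x) => /=; first exact: ltn_ord.
    by rewrite orbE /= fy inord_val.
  apply: orbit_chain => [i j /andP[ij jn]|i _].
    rewrite orbE /= !fy => /(congr1 val) /=.
    rewrite !inordK ?ltnS //; last exact: leq_trans (ltnW ij) jn.
    by move=> ji; rewrite ji ltnn in ij.
  apply/(fort_closed fortX); left; exists 0 => //.
  by rewrite orbE /= fy fb; apply: val_inj; rewrite /= inordK.
move=> m [Z [ZP ltZ Zmax]].
have sat i x y : Z i x -> f y = f x -> Z i y.
  by move=> Zx fyx; apply: (orbit_subset (ZP i).2 Zx); rewrite orbE.
(* the set of labels met by [Z i] *)
pose L i : {set 'I_n.+1} := finset (fun k => `[< exists2 x, Z i x & f x = k >]).
suff : m < #|'I_n.+1| by rewrite card_ord ltnS.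
apply: (@proper_chain_card _ _ L).
  have [[x Zx] _] := (ZP ord0).2.
  apply/finset.set0Pn; exists (f x).
  by rewrite finset.inE; apply/asboolP; exists x.
move=> i j /ltZ[sub /existsNP[x /not_implyP[Zx nZx]]]; apply/properP; split.
  apply/fintype.subsetP => k; rewrite !finset.inE => /asboolP[z Zz <-].
  by apply/asboolP; exists z => //; exact: sub.
exists (f x); rewrite finset.inE; first by apply/asboolP; exists x.
by apply/asboolP => -[z Zz fzx]; apply: nZx; apply: sat Zz _.
Qed.

(** * Colourings with prescribed finite and infinite fibres *)

Lemma infinite_inj (X : Type) : infinite_set [set: X] ->
  exists g : nat -> X, injective g.
Proof.
elim/Ppointed: X => X; first by rewrite emptyE => /(_ (finite_set0 _)).
move=> /infiniteP /pcard_leTP /injPex [g ginj].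
by exists g => i j; apply: ginj; rewrite inE.
Qed.

(** Drop the initial segment of the sequence that ends with [b]. *)
Lemma infinite_inj_avoiding (X : Type) (b : X) : infinite_set [set: X] ->
  exists2 g : nat -> X, injective g & forall k, g k <> b.
Proof.
move=> /infinite_inj [g ginj].
have [[k gk]|/forallNP nb] := pselect (exists k, g k = b); last by exists g.
exists (fun i => g (i + k.+1)) => [i j /ginj /addIn //|i].
by rewrite -gk => /ginj /eqP; rewrite -{2}[k]add0n -addSnnS eqn_add2r.
Qed.

(** Fix a sequence [g] of distinct points other than [b].  For [0 < q <= n] the
    point [g q] receives the label [q], so that all labels occur.  For [q > n]
    it receives the residue [q %% n.+1] if that label must be infinite.  All
    remaining points except [b] go to [ord_max], whose fibre is infinite
    anyway. *)
Lemma fiber_labelling (X : choiceType) (b : X) n (inf : pred 'I_n.+1) :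
    infinite_set [set: X] -> ~~ inf ord0 -> inf ord_max ->
  exists f : X -> 'I_n.+1,
    [/\ f b = ord0,
        forall x, f x = ord0 -> x = b,
        forall i, exists x, f x = i
      & forall i, finite_set (f @^-1` [set i]) <-> ~~ inf i].
Proof.
move=> infX inf0 infn; have [g ginj gb] := infinite_inj_avoiding b infX.
have max0 : ord_max != ord0 :> 'I_n.+1.
  by apply: contraNneq inf0 => <-.
pose res q : 'I_n.+1 := inord (q %% n.+1).
pose lab q := if (q == 0) || (n < q) && ~~ inf (res q) then ord_max else res q.
have labN0 q : lab q != ord0.
  rewrite /lab; case: ifPn => //; rewrite negb_or negb_and negbK => /andP[q0 H].
  apply/eqP => r0; move: H; rewrite r0 (negbTE inf0) orbF -leqNgt => qn.
  move: r0 => /(congr1 val); rewrite /= inordK ?ltn_mod // modn_small // => /eqP.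
  by rewrite (negbTE q0).
have resI (i : 'I_n.+1) : res i = i by rewrite /res modn_small ?inord_val.
have labI i : i != ord0 -> lab i = i.
  move=> i0; rewrite /lab ltnNge -ltnS ltn_ord /= orbF resI.
  by case: eqP => // /= i0'; case/eqP: i0; exact: val_inj.
pose f x := if x == b then ord0
  else if `[< exists q, g q = x >] then lab (xget 0 [set q | g q = x])
  else ord_max.
have fb : f b = ord0 by rewrite /f eqxx.
have fg q : f (g q) = lab q.
  rewrite /f ifF; last by apply/eqP; exact: gb.
  rewrite asboolT; last by exists q.
  congr lab; apply: ginj.
  exact: (@xgetPex _ 0 [set r | g r = g q] (ex_intro _ q erefl)).
have fP x : [\/ x = b, exists q, g q = x | f x = ord_max].
  rewrite /f; case: eqP => [|_]; first by constructor 1.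
  by case: asboolP; [constructor 2|constructor 3].
have f0 x : f x = ord0 -> x = b.
  case: (fP x) => [//|[q <-]|->] /eqP; last by rewrite (negbTE max0).
  by rewrite fg (negbTE (labN0 q)).
exists f; split=> //.
  move=> i; have [->|i0] := eqVneq i ord0; first by exists b.
  by exists (g i); rewrite fg labI.
move=> i; split.
  move=> fin; apply/negP => infi.
  (* indices [q.+1 * n.+1 + i] exceed [n] and have residue [i] *)
  apply: infinite_nat; pose h q := g (q.+1 * n.+1 + i).
  have -> : [set: nat] = h @^-1` (f @^-1` [set i]).
    apply/seteqP; split=> // q _; rewrite /preimage /h /= fg /lab.
    have -> : res (q.+1 * n.+1 + i) = i.
      by rewrite /res modnMDl modn_small ?inord_val.
    by rewrite infi andbF orbF mulSn -addnA addSn.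
  apply: finite_preimage fin => q r _ _ /ginj /addIn /eqP.
  by rewrite eqn_mul2r /= eqSS => /eqP.
move=> ninf; have [->|i0] := eqVneq i ord0.
  by apply: (sub_finite_set _ (finite_set1 b)) => x; exact: f0.
apply: (sub_finite_set _ (finite_set1 (g i))) => x /= fxi.
have imax : i != ord_max by apply: contraNneq ninf => ->.
case: (fP x) => [xb|[q qx]|fx].
- by move: i0; rewrite -fxi xb fb eqxx.
- subst x; move: fxi; rewrite fg /lab.
  case: ifPn => [_ /esym/eqP|]; first by rewrite (negbTE imax).
  move=> + ri; rewrite ri negb_or negb_and ninf orbF -leqNgt => /andP[_ qn].
  by rewrite -ri /= inordK ?ltn_mod // modn_small.
- by move: imax; rewrite -fxi fx eqxx.
Qed.

(** * Indicator sequences *)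

Section Indicators.
Variables (X : topologicalType) (b : X) (n : nat).
Hypothesis fortX : fort_space b.

(** The entry 0 comes from the fixed point [b].  Without an entry 1 all orbit
    closures would be finite, and finitely many of them cover [X]. *)
Lemma indicator_infinite (p : n.+1.-tuple nat) :
  infinite_set [set: X] -> indicator_sequences X n p ->
  [/\ forall i, tnth p i = 0 \/ tnth p i = 1,
      tnth p ord0 = 0,
      sorted leq p
    & tnth p ord_max = 1].
Proof.
move=> infX [S [a [_ [y [yE sp hy]]]]].
have hy01 i : tnth p i = if `[< finite_set (tg_orbit a (y i)) >] then 0 else 1.
  have := hy i; case: asboolP => [fin|inf].
    by rewrite (height_finite_orbit fortX fin) => -[].
  by rewrite (height_infinite_orbit fortX inf) => -[].
have p01 i : tnth p i = 0 \/ tnth p i = 1.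
  by rewrite hy01; case: ifP; [left|right].
have p_mono (i j : 'I_n.+1) : i <= j -> tnth p i <= tnth p j.
  move=> ij; rewrite !(tnth_nth 0).
  by apply: (sorted_leq_nth leq_trans leqnn) => //; rewrite inE size_tuple.
have clE x : exists i, closure (tg_orbit a x) = closure (tg_orbit a (y i)).
  have : [set closure (tg_orbit a x) | x in [set: X]] (closure (tg_orbit a x)).
    by exists x.
  by rewrite yE => -[i _ <-]; exists i.
split=> //.
  have [i bi] := clE b.
  have hb : height a (closure (tg_orbit a b)) = Some 0.
    apply: (height_finite_orbit fortX).
    apply: (sub_finite_set _ (finite_set1 b)).
    exact: (orbit_subset (invariant_point fortX a infX)).
  move: (hy i); rewrite -bi hb => -[p0].
  by apply/eqP; rewrite -leqn0 p0; exact: p_mono.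
have [i pi] : exists i, tnth p i = 1.
  apply: contrapT => /forallNP np; apply: infX.
  apply: (@sub_finite_set _ _
    (\bigcup_(i in [set: 'I_n.+1]) closure (tg_orbit a (y i)))).
    move=> x _; have [i xi] := clE x; exists i => //.
    by rewrite -xi; apply/subset_closure/mem_orbit.
  apply: bigcup_finite => [|i _]; first exact: finite_finset.
  have fin : finite_set (tg_orbit a (y i)).
    by have := np i; rewrite hy01; case: asboolP.
  by rewrite -((closure_id _).1 _) //; apply/(fort_closed fortX); right.
have [p0|//] := p01 ord_max.
by have := p_mono i ord_max (leq_ord i); rewrite pi p0.
Qed.

(** The acting group consists of the fibre-preserving permutations of a
    colouring whose [i]-th fibre is infinite exactly when the [i]-th entry of
    [p] is 1. *)
Lemma indicator_realized (p : n.+1.-tuple nat) :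
    infinite_set [set: X] ->
    (forall i, tnth p i = 0 \/ tnth p i = 1) ->
    tnth p ord0 = 0 -> sorted leq p -> tnth p ord_max = 1 ->
  indicator_sequences X n p.
Proof.
move=> infX p01 p0 sp pn.
have [||f [fb f0 surj fin]] :=
  @fiber_labelling X b n (fun i => tnth p i == 1) infX; rewrite ?p0 ?pn //.
have fiber_b x : f x = f b -> x = b by rewrite fb; exact: f0.
pose a := fiber_action fortX fiber_b.
have aE x : tg_orbit a x = f @^-1` [set f x].
  exact: orbit_fiber_action.
exists (fiber_perm f), a; split; first exact: (height_fibers fortX fb surj aE).
pose y i := sval (cid (surj i)).
have fy i : f (y i) = i by exact: svalP (cid (surj i)).
exists y; split=> //.
  apply/seteqP; split=> [_ [x _ <-]|_ [i _ <-]]; last by exists (y i).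
  by exists (f x) => //; rewrite !aE fy.
move=> i; have [pi|pi] := p01 i; rewrite pi.
  by apply: (height_finite_orbit fortX); rewrite aE fy; apply/fin; rewrite pi.
apply: (height_infinite_orbit fortX); rewrite aE fy => /fin.
by rewrite pi eqxx.
Qed.

Lemma indicator_finite (S : groupType) (a : transformation_group X S) :
  finite_set [set: X] -> height a [set: X] = Some n ->
  indicator_sequences X n = [set [tuple of nseq n.+1 0]].
Proof.
move=> finX ha.
have h0 (T : groupType) (c : transformation_group X T) x :
    height c (closure (tg_orbit c x)) = Some 0.
  by apply: (height_finite_orbit fortX); exact: sub_finite_set finX.
have t0 i : tnth [tuple of nseq n.+1 0] i = 0.
  by rewrite (tnth_nth 0) [nth _ _ _](nth_nseq 0 n.+1 0 i) ltn_ord.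
apply/seteqP; split=> [p [T [c [_ [y [_ _ hy]]]]]|_ ->].
  by apply: eq_from_tnth => i; have := hy i; rewrite h0 t0 => -[<-].
exists S, a; split=> //.
have [y yP] := finite_orbit_reps fortX finX ha.
exists y; split.
- apply/seteqP; split=> [_ [x _ <-]|_ [i _ <-]]; last by exists (y i).
  by have [i /orbit_eq yx] := yP x; exists i => //; rewrite yx.
- by apply/(sortedP 0) => i _; rewrite ![nth _ _ _](nth_nseq 0 n.+1 0) !if_same.
- by move=> i; rewrite h0 t0.
Qed.

End Indicators.

Theorem theorem3p3 (X : topologicalType) (b : X) (n : nat)
    (fortX : fort_space b) :
  [/\ infinite_set [set: X] ->
        indicator_sequences X n =
        [set p : n.+1.-tuple nat |
           [/\ forall i, tnth p i = 0 \/ tnth p i = 1,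
               tnth p ord0 = 0,
               sorted leq p
             & tnth p ord_max = 1]],
      finite_set [set: X] ->
        (exists (S : groupType) (a : transformation_group X S),
           height a [set: X] = Some n) ->
        indicator_sequences X n = [set [tuple of nseq n.+1 0]]
    & infinite_set [set: X] ->
        forall (S : groupType) (a : transformation_group X S),
          enat_lt (Some 0) (height a [set: X])].
Proof.
split.
- move=> infX; apply/seteqP; split=> p.
    exact: (indicator_infinite fortX infX).
  by move=> [p01 p0 sp pn]; exact: (indicator_realized fortX).
- by move=> finX [S [a ha]]; exact: (indicator_finite fortX finX ha).
- by move=> infX S a; exact: (height_gt0 fortX a infX).
Qed.
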